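(* Let $p=(p_1,\dots,p_n)$ be a probability vector satisfying condition $\mathcal{C}_1$ for a constant $\delta\in(0,1)$ and some $\epsilon>0$, and let $x\in\mathbb{R}^n$ be any load vector with corresponding sorted normalized vector $y$. For $\alpha>0$ let $\Phi_i=e^{\alpha y_i}$, $\Psi_i=e^{-\alpha y_i}$, $\Phi=\sum_i\Phi_i$, $\Psi=\sum_i\Psi_i$, $\Gamma=\Phi+\Psi$. For some $K>0$ define \[ \Delta\overline{\Phi} := \sum_{i=1}^n \Phi_i\Big(\Big(p_i-\frac1n\Big)\alpha + K\frac{\alpha^2}{n}\Big),\qquad \Delta\overline{\Psi} := \sum_{i=1}^n \Psi_i\Big(\Big(\frac1n-p_i\Big)\alpha + K\frac{\alpha^2}{n}\Big). \] Then there exists a constant $c:=c(\delta)>0$ such that for any $0<\alpha<\min\big(1,\frac{\epsilon\delta}{8K}\big)$, \[ \Delta\overline{\Gamma}:=\Delta\overline{\Phi}+\Delta\overline{\Psi}\le -\frac{\epsilon\delta}{8}\cdot\frac{\alpha}{n}\cdot\Gamma + c\cdot\epsilon\cdot\alpha. \]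
   Context: For a load vector $x=(x_1,\dots,x_n)$, the normalized load vector is $x_i-\frac1n\sum_j x_j$, and $y$ denotes this vector sorted decreasingly, $y_1\ge y_2\ge\dots\ge y_n$ (so $\sum_i y_i=0$). Condition $\mathcal{C}_1$ (with $\delta,\epsilon$): for all $1\le k\le \delta n$, $\sum_{i=1}^k p_i \le (1-\epsilon)\frac{k}{n}$, and for all $\delta n+1\le k\le n$, $\sum_{i=k}^n p_i \ge \big(1+\epsilon\frac{\delta}{1-\delta}\big)\frac{n-k+1}{n}$. *)

(* Defs.v *)
From mathcomp Require Import all_boot all_order all_algebra.
From mathcomp Require Import reals.
From mathcomp.analysis Require Import sequences exp.

Set Implicit Arguments.
Unset Strict Implicit.
Unset Printing Implicit Defensive.

Import Order.TTheory GRing.Theory Num.Theory.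

Local Open Scope ring_scope.

(* Vectors indexed by 1..n are row vectors indexed by 'I_n, so the i-th entry
   of the text is the entry of index i.-1 here. *)
Section Defs.
Context {R : realType}.
Implicit Types (n : nat) (delta eps alpha K : R).

Definition prob_vector n (p : 'rV[R]_n) : Prop :=
  (forall i, 0 <= p 0 i) /\ \sum_(i < n) p 0 i = 1.

Definition condC1 delta eps n (p : 'rV[R]_n) : Prop :=
  (forall k : nat, (1 <= k)%N -> k%:R <= delta * n%:R ->
     \sum_(i < n | (i.+1 <= k)%N) p 0 i <= (1 - eps) * (k%:R / n%:R)) /\
  (forall k : nat, delta * n%:R + 1 <= k%:R -> (k <= n)%N ->
     (1 + eps * (delta / (1 - delta))) * ((n%:R - k%:R + 1) / n%:R)
       <= \sum_(i < n | (k <= i.+1)%N) p 0 i).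

Definition normalized_load n (x : 'rV[R]_n) : 'rV[R]_n :=
  \row_i (x 0 i - n%:R^-1 * \sum_(j < n) x 0 j).

Definition sorted_normalized_load n (x : 'rV[R]_n) : 'rV[R]_n :=
  \row_i nth 0 (sort (fun a b : R => b <= a)
                  [seq normalized_load x 0 j | j <- enum 'I_n]) i.

Definition Phi_i alpha n (y : 'rV[R]_n) (i : 'I_n) : R := expR (alpha * y 0 i).

Definition Psi_i alpha n (y : 'rV[R]_n) (i : 'I_n) : R :=
  expR (- (alpha * y 0 i)).

Definition Phi alpha n (y : 'rV[R]_n) : R := \sum_(i < n) Phi_i alpha y i.

Definition Psi alpha n (y : 'rV[R]_n) : R := \sum_(i < n) Psi_i alpha y i.

Definition Gamma alpha n (y : 'rV[R]_n) : R := Phi alpha y + Psi alpha y.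

Definition DeltaPhi K alpha n (p y : 'rV[R]_n) : R :=
  \sum_(i < n) Phi_i alpha y i *
    ((p 0 i - n%:R^-1) * alpha + K * (alpha ^+ 2 / n%:R)).

Definition DeltaPsi K alpha n (p y : 'rV[R]_n) : R :=
  \sum_(i < n) Psi_i alpha y i *
    ((n%:R^-1 - p 0 i) * alpha + K * (alpha ^+ 2 / n%:R)).

Definition DeltaGamma K alpha n (p y : 'rV[R]_n) : R :=
  DeltaPhi K alpha p y + DeltaPsi K alpha p y.

End Defs.

(* Main.v *)
Require Import Defs.
From mathcomp Require Import all_boot all_order all_algebra.
From mathcomp Require Import reals.
From mathcomp.analysis Require Import sequences exp.
From mathcomp Require Import ring lra zify.

Import Order.TTheory GRing.Theory Num.Theory.
Local Open Scope ring_scope.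

(** Write F_i = exp(alpha y_i) - exp(-alpha y_i) and let t be the 1-based index with
    t - 1 < delta n <= t.  As the p_i - 1/n sum to 0, F_i may be replaced by
    F_i - F_t in the sum of (1/n - p_i) F_i; Abel summation on each side of t
    then bounds that sum below by (eps delta / n) T, where
    T = \sum_i |F_i - F_t|.  Since the y_i sum to 0, a chord inequality for
    the hyperbolic sine gives n |F_t| <= 2 T, hence
    Gamma <= \sum_i |F_i| + 2 n <= 3 T + 2 n, and the linear term beats the
    K alpha^2 / n terms. *)

(** * Sums over ranges of indices and Abel summation *)

Lemma sumr_ord_lt {R : realType} (n m : nat) (c : R) : (m <= n)%N ->
  \sum_(i < n | (i < m)%N) c = c * m%:R.
Proof.
by move=> mn; rewrite (big_ord_narrow mn) sumr_const card_ord mulr_natr.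
Qed.

Lemma sumr_ord_ge {R : realType} (n m : nat) (c : R) : (m <= n)%N ->
  \sum_(i < n | (m <= i)%N) c = c * (n%:R - m%:R).
Proof.
move=> mn.
have := sumr_ord_lt n n c (leqnn n).
rewrite (bigID (fun i : 'I_n => (i < m)%N)) /=.
have -> : \sum_(i < n | (i < n)%N && (i < m)%N) c = c * m%:R.
  rewrite -(sumr_ord_lt n m c mn); apply: eq_bigl => i.
  by rewrite ltn_ord.
have -> : \sum_(i < n | (i < n)%N && ~~ (i < m)%N) c
          = \sum_(i < n | (m <= i)%N) c.
  by apply: eq_bigl => i; rewrite ltn_ord -leqNgt.
by move=> h; rewrite mulrBr -h addrC addrK.
Qed.

(** Induction on [n]: the last value of [a] is a lower bound for all the others, so it can be
    factored out of the sum; it may then be lowered to [c] because the total of [q] is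
    nonnegative. *)
Lemma abel_sum_ge {R : realType} (n : nat) (q a : 'I_n -> R) (c : R) :
  (forall k : nat, 0 <= \sum_(i < n | (i < k)%N) q i) ->
  (forall i j : 'I_n, (i <= j)%N -> a j <= a i) ->
  (forall i, c <= a i) ->
  c * \sum_(i < n) q i <= \sum_(i < n) q i * a i.
Proof.
elim: n q a c => [|n IH] q a c hq ha hc; first by rewrite !big_ord0 mulr0.
rewrite [X in _ <= X]big_ord_recr /=.
have hq0 : 0 <= \sum_(i < n.+1) q i.
  suff -> : \sum_(i < n.+1) q i = \sum_(i < n.+1 | (i < n.+1)%N) q i by [].
  by apply: eq_bigl => i; rewrite ltn_ord.
have h : a ord_max * \sum_(i < n) q (widen_ord (leqnSn n) i)
    <= \sum_(i < n) q (widen_ord (leqnSn n) i) * a (widen_ord (leqnSn n) i).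
  apply: (IH (fun i => q (widen_ord (leqnSn n) i))
             (fun i => a (widen_ord (leqnSn n) i))) => [k|i j ij|i].
  (* Prefixes of the shortened sequence stop at [n], hence the cutoff [minn k n]. *)
  - suff -> : \sum_(i < n | (i < k)%N) q (widen_ord (leqnSn n) i)
        = \sum_(i < n.+1 | (i < minn k n)%N) q i by exact: hq.
    rewrite [RHS]big_mkcond big_ord_recr /=.
    rewrite ltnNge geq_minr /= addr0 big_mkcond /=.
    by apply: eq_bigr => i _; rewrite leq_min ltn_ord andbT.
  - exact: ha.
  - by apply: ha => /=; apply: ltnW.
apply: le_trans (_ : a ord_max * \sum_(i < n.+1) q i <= _).
  exact: ler_wpM2r.
by rewrite big_ord_recr /= mulrDr lerD // mulrC.
Qed.

Lemma abel_prefix_ge0 {R : realType} (n : nat) (q a : 'I_n -> R) :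
  (forall k : nat, 0 <= \sum_(i < n | (i < k)%N) q i) ->
  (forall i j : 'I_n, (i <= j)%N -> a j <= a i) -> (forall i, 0 <= a i) ->
  0 <= \sum_(i < n) q i * a i.
Proof. by move=> hq ha a0; have := abel_sum_ge n q a 0 hq ha a0; rewrite mul0r. Qed.

Lemma abel_suffix_ge0 {R : realType} (n : nat) (q a : 'I_n -> R) :
  (forall k : nat, 0 <= \sum_(i < n | (k <= i)%N) q i) ->
  (forall i j : 'I_n, (i <= j)%N -> a i <= a j) -> (forall i, 0 <= a i) ->
  0 <= \sum_(i < n) q i * a i.
Proof.
move=> hq ha a0; rewrite (reindex_inj rev_ord_inj) /=.
apply: abel_prefix_ge0 => [k|i j ij|i]; last exact: a0.
- suff -> : \sum_(i < n | (i < k)%N) q (rev_ord i)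
      = \sum_(i < n | (n - k <= i)%N) q i by exact: hq.
  rewrite [RHS](reindex_inj rev_ord_inj) /=; apply: eq_bigl => i.
  by have := ltn_ord i; lia.
- by apply: ha => /=; lia.
Qed.

Lemma sorted_normalized_load_le {R : realType} (n : nat) (x : 'rV[R]_n)
    (i j : 'I_n) : (i <= j)%N ->
  sorted_normalized_load x 0 j <= sorted_normalized_load x 0 i.
Proof.
move=> ij; rewrite !mxE.
have tr : transitive (fun a b : R => b <= a) by move=> a b c /[swap]; apply: le_trans.
apply: (sorted_leq_nth tr (@lexx _ R)) => //.
- by apply: sort_sorted => a b; apply: le_total.
- by rewrite inE size_sort size_map size_enum_ord.
- by rewrite inE size_sort size_map size_enum_ord.
Qed.

Lemma sum_sorted_normalized_load {R : realType} (n : nat) (x : 'rV[R]_n) :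
  \sum_(i < n) sorted_normalized_load x 0 i = 0.
Proof.
case: n x => [|n] x; first by rewrite big_ord0.
under eq_bigr do rewrite mxE.
set s := sort _ _.
have ss : size s = n.+1 by rewrite size_sort size_map size_enum_ord.
transitivity (\sum_(a <- s) a).
  by rewrite [RHS](big_nth 0) ss big_mkord.
rewrite (perm_big _ (permEl (perm_sort _ _))) big_map big_enum /=.
under eq_bigr do rewrite mxE.
rewrite sumrB sumr_const card_ord -(mulr_natl (_ * _)) mulrA.
by rewrite divff ?mul1r ?subrr // pnatr_eq0.
Qed.

(** * Inequalities for [dsinh], twice the hyperbolic sine *)

Definition dsinh {R : realType} (x : R) : R := expR x - expR (- x).

Lemma dsinhN {R : realType} (x : R) : dsinh (- x) = - dsinh x.
Proof. by rewrite /dsinh opprK opprB. Qed.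

Lemma dsinh_le {R : realType} (x y : R) : x <= y -> dsinh x <= dsinh y.
Proof. by move=> xy; rewrite /dsinh lerB // ler_expR // lerN2. Qed.

Lemma dsinh_ge0 {R : realType} (x : R) : 0 <= x -> 0 <= dsinh x.
Proof. by move=> x0; rewrite /dsinh subr_ge0 ler_expR; lra. Qed.

(* A weak form of the convexity of sinh on the positive half-line. *)
Lemma dsinh_star {R : realType} (s b : R) : 0 <= s -> s <= b ->
  dsinh s * (s + b) <= 2 * s * dsinh b.
Proof.
move=> s0 sb.
(* Both [hb] and [hs] come from 1 + u <= exp u. The claim is 2s times [hb] combined with (b - s)
   times [hs]. *)
have hb : dsinh s + (b - s) * expR s <= dsinh b.
  have e1 : expR s * (1 + (b - s)) <= expR b.
    have {2}-> : b = s + (b - s) by ring.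
    rewrite expRD ler_wpM2l ?expR_ge0 //.
    exact: expR_ge1Dx.
  have e2 : expR (- b) <= expR (- s) by rewrite ler_expR lerN2.
  rewrite /dsinh; lra.
have hs : dsinh s <= 2 * s * expR s.
  have : expR s * (1 + (- (2 * s))) <= expR (- s).
    have -> : - s = s + - (2 * s) :> R by ring.
    rewrite expRD ler_wpM2l ?expR_ge0 //; exact: expR_ge1Dx.
  rewrite /dsinh; lra.
have h1 : 2 * s * (dsinh s + (b - s) * expR s) <= 2 * s * dsinh b.
  by apply: ler_wpM2l => //; lra.
have h2 : (b - s) * dsinh s <= (b - s) * (2 * s * expR s).
  by apply: ler_wpM2l => //; lra.
lra.
Qed.

(** For z >= b the left side is nonpositive. For 0 <= z < b, [dsinh_star] is combined with
    monotonicity. For z = - s < 0, either s <= b and the bound is direct, or b < s and [dsinh_star]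
    applies with the roles exchanged. *)
Lemma dsinh_chord {R : realType} (b z : R) : 0 < b ->
  dsinh b * (b - z) <= 2 * b * `|dsinh z - dsinh b|.
Proof.
move=> b0; have Fb0 := dsinh_ge0 b (ltW b0).
have [bz|zb] := leP b z.
  apply: (@le_trans _ _ 0); first by rewrite mulr_ge0_le0 // subr_le0.
  by rewrite mulr_ge0 //; lra.
apply: le_trans (_ : 2 * b * (dsinh b - dsinh z) <= _); last first.
  by apply: ler_wpM2l; [lra|rewrite distrC ler_norm].
have [z0|z0] := leP 0 z.
  have h := dsinh_star z b z0 (ltW zb).
  have Fz0 := dsinh_ge0 z z0.
  have Fzb := dsinh_le z b (ltW zb).
  have : 0 <= (dsinh b - dsinh z) * (b - z) by rewrite mulr_ge0 //; lra.
  lra.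
have [s zs] : exists s, z = - s by exists (- z); rewrite opprK.
have s0 : 0 <= s by lra.
rewrite zs dsinhN !opprK.
have Fs0 := dsinh_ge0 s s0.
have [sb|bs] := leP s b.
  have : 0 <= dsinh b * (b - s) by rewrite mulr_ge0 //; lra.
  have : 0 <= b * dsinh s by rewrite mulr_ge0 //; lra.
  lra.
have h := dsinh_star b s (ltW b0) (ltW bs).
have : 0 <= b * dsinh b by rewrite mulr_ge0 //; lra.
lra.
Qed.

(** Oddness reduces to b >= 0. For b > 0, summing [dsinh_chord] over all [z i] works because the
    gaps [b - z i] add up to n b; the factor b then cancels. *)
Lemma dsinh_center {R : realType} (n : nat) (z : 'I_n -> R) (b : R) :
  \sum_(i < n) z i = 0 ->
  n%:R * `|dsinh b| <= 2 * \sum_(i < n) `|dsinh (z i) - dsinh b|.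
Proof.
wlog b0 : z b / 0 <= b => [hw|] z0.
  have [|b0] := leP 0 b; first by move=> b0; apply: hw.
  have := hw (fun i => - z i) (- b); rewrite sumrN z0 oppr0 dsinhN normrN.
  have -> : \sum_(i < n) `|dsinh (- z i) - - dsinh b|
            = \sum_(i < n) `|dsinh (z i) - dsinh b|.
    by apply: eq_bigr => i _; rewrite dsinhN -opprD normrN.
  by apply => //; lra.
have [->|bn0] := eqVneq b 0.
  rewrite {1}/dsinh oppr0 subrr normr0 mulr0.
  by apply: mulr_ge0 => //; apply: sumr_ge0.
have {bn0}b0 : 0 < b by rewrite lt_def bn0.
rewrite (ger0_norm (dsinh_ge0 b (ltW b0))) -(ler_pM2l b0).
have -> : b * (n%:R * dsinh b) = \sum_(i < n) dsinh b * (b - z i).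
  rewrite -mulr_sumr sumrB z0 subr0 sumr_const card_ord -[b *+ n]mulr_natr.
  by ring.
rewrite mulrA (mulrC b 2) mulr_sumr; apply: ler_sum => i _.
exact: dsinh_chord.
Qed.

(** The sum of two numbers is their distance plus twice the smaller one, and the smaller exponential
    is at most 1. *)
Lemma expRD_le_norm_dsinh {R : realType} (x : R) :
  expR x + expR (- x) <= `|dsinh x| + 2.
Proof.
rewrite /dsinh; have [x0|x0] := leP 0 x.
  have : expR (- x) <= 1 by rewrite -expR0 ler_expR; lra.
  by have := ler_norm (expR x - expR (- x)); lra.
have : expR x <= 1 by rewrite -expR0 ler_expR; lra.
by have := ler_norm (expR (- x) - expR x); rewrite distrC; lra.
Qed.

(** * The pivot index and the linear drift *)

Lemma split_index {R : realType} (n : nat) (delta : R) :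
  0 < delta -> delta < 1 -> (0 < n)%N ->
  exists t : 'I_n, t%:R < delta * n%:R /\ delta * n%:R <= t%:R + 1.
Proof.
move=> d0 d1 n0; have nR : 0 < n%:R :> R by rewrite ltr0n.
have ex : exists k : nat, delta * n%:R <= k%:R.
  by exists n; rewrite ler_piMl ?ltW.
case: (ex_minnP ex) => -[|t] ht tmin.
  by move: ht; rewrite leNgt mulr_gt0.
have tn : (t < n)%N by apply: tmin; rewrite ler_piMl ?ltW.
exists (Ordinal tn) => /=; split; last by rewrite -natr1 in ht.
by rewrite ltNge; apply/negP => /tmin; rewrite ltnn.
Qed.

(** Per index, the prefix condition leaves a slack eps / n and the suffix condition a slack eps
    delta / ((1 - delta) n); both are at least eps delta / n. *)
Lemma drift_ge {R : realType} (n : nat) (delta eps : R) (p : 'rV[R]_n)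
    (F : 'I_n -> R) (t : 'I_n) :
  0 < delta -> delta < 1 -> 0 < eps ->
  \sum_(i < n) p 0 i = 1 -> condC1 delta eps p ->
  (forall i j : 'I_n, (i <= j)%N -> F j <= F i) ->
  t%:R < delta * n%:R -> delta * n%:R <= t%:R + 1 ->
  eps * delta / n%:R * \sum_(i < n) `|F i - F t|
    <= \sum_(i < n) (n%:R^-1 - p 0 i) * F i.
Proof.
move=> d0 d1 e0 sp [pre suf] Fle t1 t2.
have n0 : (0 < n)%N by apply: leq_ltn_trans (ltn_ord t).
have nR : n%:R != 0 :> R by rewrite pnatr_eq0 -lt0n.
set N := n%:R^-1 : R.
have N0 : 0 <= N by rewrite invr_ge0.
set kap := delta / (1 - delta).
have kd : delta <= kap by rewrite ler_pdivlMr; [nra|lra].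
(* [condC1] makes the prefix sums of [q] and the suffix sums of [r] nonnegative; cutting both to 0
   across [t] keeps every such sum within the range of the condition. The weights [a] and [b] are
   the positive and negative parts of [F i - F t], monotone in opposite directions. *)
pose q (i : 'I_n) := if (i < t)%N then (1 - eps) * N - p 0 i else 0.
pose r (i : 'I_n) := if (t < i)%N then p 0 i - (1 + eps * kap) * N else 0.
pose a (i : 'I_n) := Num.max (F i - F t) 0.
pose b (i : 'I_n) := Num.max (F t - F i) 0.
have hq : 0 <= \sum_(i < n) q i * a i.
  apply: abel_prefix_ge0 => [k|i j /Fle Fij|i]; rewrite /a.
  - have mt : (minn k t <= t)%N by exact: geq_minr.
    have -> : \sum_(i < n | (i < k)%N) q i
        = \sum_(i < n | (i < minn k t)%N) ((1 - eps) * N - p 0 i).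
      rewrite big_mkcond [RHS]big_mkcond; apply: eq_bigr => i _.
      by rewrite leq_min /q; case: (_ < k)%N; case: (_ < t)%N.
    move: (minn k t) mt => m mt.
    rewrite sumrB (sumr_ord_lt _ _ _ (leq_trans mt (ltnW (ltn_ord t)))).
    case: m mt => [|m] mt; first by rewrite !big_pred0 ?mulr0 ?subr0.
    rewrite subr_ge0.
    have := pre m.+1 isT.
    rewrite -[_ * N * _]mulrA [N * _]mulrC; apply.
    by apply: le_trans (ltW t1); rewrite ler_nat.
  - by rewrite ge_max !le_max lexx orbT andbT lerB.
  - by rewrite le_max lexx orbT.
have hr : 0 <= \sum_(i < n) r i * b i.
  apply: abel_suffix_ge0 => [k|i j /Fle Fij|i]; rewrite /b.
  - have mt : (t < maxn k t.+1)%N by exact: leq_maxr.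
    have -> : \sum_(i < n | (k <= i)%N) r i
        = \sum_(i < n | (maxn k t.+1 <= i)%N) (p 0 i - (1 + eps * kap) * N).
      rewrite big_mkcond [RHS]big_mkcond; apply: eq_bigr => i _.
      by rewrite geq_max /r; case: (k <= _)%N; case: (t < _)%N.
    move: (maxn k t.+1) mt => m mt.
    have [nm|mn] := leqP n m.
      rewrite big_pred0 // => i; apply/negbTE; rewrite -ltnNge.
      exact: leq_trans (ltn_ord i) nm.
    rewrite sumrB (sumr_ord_ge _ _ _ (ltnW mn)) subr_ge0.
    (* The 0-based start [m] is k = m + 1 in the condition, and m >= t + 1 gives k >= t + 2 >= delta
       n + 1. *)
    have := suf m.+1.
    have -> : n%:R - m.+1%:R + 1 = n%:R - m%:R :> R by rewrite -natr1; ring.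
    rewrite -[_ * N * _]mulrA [N * _]mulrC; apply => //.
    apply: le_trans (_ : t%:R + 1 + 1 <= _); first by rewrite lerD2r.
    by rewrite !natr1 ler_nat.
  - by rewrite ge_max !le_max lexx orbT andbT lerB.
  - by rewrite le_max lexx orbT.
have -> : \sum_(i < n) (N - p 0 i) * F i
          = \sum_(i < n) (N - p 0 i) * (F i - F t).
  under [RHS]eq_bigr do rewrite mulrBr.
  rewrite [RHS]sumrB -[X in _ - X]mulr_suml sumrB sp sumr_const card_ord.
  by rewrite -[N *+ n]mulr_natr mulVf // subrr mul0r subr0.
(* The comparison with [q i * a i + r i * b i] is termwise: it uses delta <= 1 before [t], [kd]
   after [t], and at [t] every term vanishes. *)
rewrite -subr_ge0 mulr_sumr -sumrB.
apply: le_trans (addr_ge0 hq hr) _; rewrite -big_split /=.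
apply: ler_sum => i _; rewrite /q /r /a /b -/N.
have eN : 0 <= eps * N by rewrite mulr_ge0 // ltW.
case: (ltngtP i t) => it.
- have Fti := Fle _ _ (ltnW it).
  rewrite (max_idPl _) ?subr_ge0 // ger0_norm ?subr_ge0 // mul0r addr0.
  rewrite -mulrBl ler_wpM2r ?subr_ge0 //.
  have : eps * N * delta <= eps * N * 1 by apply: ler_wpM2l => //; lra.
  lra.
- have Fti := Fle _ _ (ltnW it).
  rewrite [in X in _ + X](max_idPl _) ?subr_ge0 // ler0_norm ?subr_le0 //.
  rewrite mul0r add0r opprB -[F i - F t]opprB mulrN -mulNr -mulrBl.
  rewrite ler_wpM2r ?subr_ge0 //.
  have : eps * N * delta <= eps * N * kap by apply: ler_wpM2l.
  lra.
- have -> : i = t by apply: val_inj.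
  by rewrite subrr normr0 !mulr0 !mul0r addr0 subr0.
Qed.

Theorem theorem3p1 (R : realType) (delta : R)
    (hdelta0 : 0 < delta) (hdelta1 : delta < 1) :
  exists c : R, 0 < c /\
    forall (n : nat) (eps K : R) (p x : 'rV[R]_n),
      0 < eps -> 0 < K ->
      prob_vector p -> condC1 delta eps p ->
      forall alpha : R,
        0 < alpha -> alpha < Num.min 1 (eps * delta / (8 * K)) ->
        let y := sorted_normalized_load x in
        DeltaGamma K alpha p y
          <= - (eps * delta / 8) * (alpha / n%:R) * Gamma alpha y
             + c * eps * alpha.
Proof.
(* A quarter of the bound Gamma <= 4 T + 2 n, times eps delta alpha / n, leaves the constant eps
   delta alpha / 2. *)
exists (delta / 2); split; first by rewrite divr_gt0.
move=> n eps K p x e0 K0 [_ sp] hC alpha a0; rewrite lt_min => /andP[_ aK].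
cbv zeta; set y := sorted_normalized_load x.
have n0 : (0 < n)%N.
  by case: n {hC y x} p sp => // p; rewrite big_ord0 => /esym/eqP; rewrite oner_eq0.
have nR : 0 < n%:R :> R by rewrite ltr0n.
pose z i := alpha * y 0 i.
pose F i := dsinh (z i).
have z0 : \sum_(i < n) z i = 0.
  by rewrite -mulr_sumr sum_sorted_normalized_load mulr0.
have [t [t1 t2]] := split_index n delta hdelta0 hdelta1 n0.
set T := \sum_(i < n) `|F i - F t|.
have drift : eps * delta / n%:R * T <= \sum_(i < n) (n%:R^-1 - p 0 i) * F i.
  apply: drift_ge => // i j ij; apply: dsinh_le; rewrite /z ler_pM2l //.
  exact: sorted_normalized_load_le.
have center : n%:R * `|F t| <= 2 * T by exact: dsinh_center.
have GT : Gamma alpha y <= 3 * T + 2 * n%:R.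
  rewrite /Gamma /Phi /Psi -big_split /=.
  apply: le_trans (_ : \sum_(i < n) (`|F i - F t| + (`|F t| + 2)) <= _).
    apply: ler_sum => i _; apply: le_trans (expRD_le_norm_dsinh (z i)) _.
    by have := ler_normD (F i - F t) (F t); rewrite subrK -/(F i); lra.
  rewrite big_split /= sumr_const card_ord -[(`|F t| + 2) *+ n]mulr_natr -/T.
  lra.
have T0 : 0 <= T by rewrite sumr_ge0.
have -> : DeltaGamma K alpha p y
    = K * alpha * (alpha / n%:R) * Gamma alpha y
      - alpha * \sum_(i < n) (n%:R^-1 - p 0 i) * F i.
  rewrite /DeltaGamma /DeltaPhi /DeltaPsi /Gamma /Phi /Psi -!big_split /=.
  rewrite !mulr_sumr -sumrB; apply: eq_bigr => i _.
  by rewrite /F /dsinh /Phi_i /Psi_i -/(z i); ring.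
have G0 : 0 <= Gamma alpha y.
  by rewrite addr_ge0 // sumr_ge0 // => i _; apply: expR_ge0.
have an0 : 0 <= alpha / n%:R by rewrite divr_ge0 // ltW.
(* The upper bound on [alpha] makes the quadratic terms cost at most one eighth of eps delta (alpha
   / n) Gamma; the conclusion asks for a second eighth. *)
have Ka : K * alpha <= eps * delta / 8.
  have := ltW aK; rewrite ler_pdivlMr ?mulr_gt0 //; lra.
have h1 : K * alpha * (alpha / n%:R) * Gamma alpha y
    <= eps * delta / 8 * (alpha / n%:R) * Gamma alpha y.
  by rewrite ler_wpM2r // ler_wpM2r.
have h2 := ler_wpM2l (ltW a0) drift.
have ed0 : 0 <= eps * delta * (alpha / n%:R).
  by apply: mulr_ge0 => //; apply: mulr_ge0; apply: ltW.
(* Weakening 3 T to 4 T lets the two eighths of Gamma be paid by exactly the drift term in T. *)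
have h3 : eps * delta * (alpha / n%:R) * Gamma alpha y
    <= eps * delta * (alpha / n%:R) * (4 * T + 2 * n%:R).
  by apply: ler_wpM2l => //; lra.
have h4 : eps * delta * (alpha / n%:R) * (2 * n%:R) = 2 * (eps * delta * alpha).
  by field; rewrite gt_eqF.
have h5 : alpha * (eps * delta / n%:R * T) = eps * delta * (alpha / n%:R) * T.
  by ring.
lra.
Qed.
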